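(* Let $c$ and $n$ be odd positive integers with $n>c>\frac{n}{2}$. Let $K$ be the set partition of $S_c$ whose only part with more than one element is the set of cyclic shifts of the identity, $\{12\cdots c,\ 23\cdots c1,\ \ldots,\ c12\cdots(c-1)\}$. Then, under the $K$-equivalence on $S_n$, the number of odd non-avoiders exceeds the number of even non-avoiders by $n\,C_{\frac{n-c-2}{2}}$; that is, the odd nontrivial class has $n\,C_{\frac{n-c-2}{2}}$ more permutations than the even nontrivial class. Here $C_r=\frac{1}{r+1}\binom{2r}{r}$ is the $r$th Catalan number.
   Context: Permutations are written in one-line notation as words. The order permutation (standardization) of a word $u$ of distinct positive integers of length $\ell$ is the unique $\pi\in S_\ell$ with $\pi_i<\pi_j$ iff $u_i<u_j$. The $K$-equivalence on $S_n$ is the equivalence relation generated by declaring $\phi\equiv\psi$ whenever $\phi=aub$ and $\psi=avb$ for words $a,b,u,v$ with $u,v$ of length $c$ whose order permutations lie in the same part of $K$. A hit is a contiguous subword of length $c$ whose order permutation is a cyclic shift of the identity of $S_c$; a non-avoider is a permutation containing a hit. A class is nontrivial if it has more than one element. Since $c$ is odd, every transformation preserves the parity (sign) of the permutation, and for $n>c$ the nontrivial classes are exactly the set of even non-avoiders (the ''even nontrivial class'') and the set of odd non-avoiders (the ''odd nontrivial class''). *)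

(* Defs.v *)
From mathcomp Require Import all_boot all_order all_fingroup.
Set Implicit Arguments. Unset Strict Implicit. Unset Printing Implicit Defensive.

Definition oneline n (s : 'S_n) : seq nat := [seq val (s i) | i <- enum 'I_n].

(* Order permutation (standardization) of a word of distinct naturals,
   0-based: the entry at position i is the number of entries smaller than u_i. *)
Definition std (u : seq nat) : seq nat := [seq count (fun y => y < x) u | x <- u].

Definition cshift (c k : nat) : seq nat := [seq (j + k) %% c | j <- iota 0 c].

Definition window (c i : nat) (w : seq nat) : seq nat := take c (drop i w).

Definition hit_at (c : nat) (w : seq nat) (i : nat) : bool :=
  (i + c <= size w) && [exists k : 'I_c, std (window c i w) == cshift c k].

Definition nonavoider (c n : nat) (s : 'S_n) : bool :=
  [exists i : 'I_n.+1, hit_at c (oneline s) i].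

Definition catalan (r : nat) : nat := 'C(r.*2, r) %/ r.+1.

(* Main.v *)
Require Import Defs.
From mathcomp Require Import all_boot all_order all_fingroup.
From mathcomp Require Import all_algebra zify.
Set Implicit Arguments. Unset Strict Implicit. Unset Printing Implicit Defensive.

(* Put m = n - c and a = c - m, so m is even, a is odd and n = a + 2m.  A window
   is a hit iff its entries are in cyclic order.  Since n is odd, cyclic shifts
   of positions and of values are even permutations, so one may rotate position
   m to 0 and count only permutations t with t(0) = 0, at the price of a factor
   n; the window at i is then a hit iff t is increasing off the block
   [a+i, a+m+i) of m positions.  If the hits under consideration leave a common
   position outside their windows, exchanging the value v at that position with
   its partner in {1,2}, {3,4}, ..., {n-2,n-1} reverses signs.  By inclusion and
   exclusion only the t with hits at 0 and m and none in between survive, and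
   they contribute negatively.  Such t are shuffles of two increasing runs,
   that is, lattice paths that stay positive between their ends; exchanging a
   pair of partner values lying in different runs cancels all of them except
   those whose steps come in equal pairs.  These are even, and halving the path
   identifies them with Dyck words of length m - 2. *)

(** * Cyclic words *)

Definition cyc3 (x y z : nat) : bool :=
  [|| x < y < z, y < z < x | z < x < y].

Lemma modn_add_lt (c x k : nat) :
  x < c -> k < c -> (x + k) %% c = if x + k < c then x + k else x + k - c.
Proof.
move=> xc kc; case: ltnP => h; first by rewrite modn_small.
by rewrite -{1}(subnK h) modnDr modn_small //; lia.
Qed.

Lemma cyc3_addmod (c x y z k : nat) : x < c -> y < c -> z < c -> k < c ->
  cyc3 ((x + k) %% c) ((y + k) %% c) ((z + k) %% c) = cyc3 x y z.
Proof.
move=> xc yc zc kc; rewrite !modn_add_lt // /cyc3.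
case: (ltnP (x + k)) => ?; case: (ltnP (y + k)) => ?; case: (ltnP (z + k)) => ?; lia.
Qed.

Lemma size_std u : size (std u) = size u.
Proof. by rewrite size_map. Qed.

Lemma nth_std u j : j < size u ->
  nth 0 (std u) j = count (fun y => y < nth 0 u j) u.
Proof. by move=> ju; rewrite (nth_map 0). Qed.


Lemma size_cshift c k : size (cshift c k) = c.
Proof. by rewrite size_map size_iota. Qed.

Lemma nth_cshift c k j : j < c -> nth 0 (cshift c k) j = (j + k) %% c.
Proof. by move=> jc; rewrite (nth_map 0) ?size_iota // nth_iota. Qed.

Lemma perm_cshift c k : k < c -> perm_eq (cshift c k) (iota 0 c).
Proof.
move=> kc; apply: uniq_perm; rewrite ?iota_uniq //.
  rewrite map_inj_in_uniq ?iota_uniq // => x y; rewrite !mem_iota => xc yc.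
  by rewrite !modn_add_lt //; case: (ltnP (x + k)) => ?; case: (ltnP (y + k)) => ?; lia.
move=> x; rewrite mem_iota; apply/mapP/idP => [[y yc ->]|xc].
  by rewrite add0n ltn_mod; lia.
exists ((x + (c - k)) %% c); first by rewrite mem_iota add0n ltn_mod; lia.
by rewrite modnDml -addnA subnK 1?ltnW // modnDr modn_small.
Qed.

Lemma count_ltn_iota c x : x <= c -> count (fun y => y < x) (iota 0 c) = x.
Proof.
move=> xc; rewrite -(subnKC xc) iotaD count_cat.
rewrite (eq_in_count (a2 := predT)) ?count_predT ?size_iota; last first.
  by move=> y; rewrite mem_iota.
rewrite (eq_in_count (a2 := pred0)) ?count_pred0 ?addn0 // => y.
by rewrite mem_iota add0n => /andP[xy _] /=; lia.
Qed.


(** Entries below the smaller value are also below the larger one, and the smaller value itself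
    makes the inclusion strict. *)
Lemma nth_std_lt u p q : p < size u -> q < size u ->
  (nth 0 (std u) p < nth 0 (std u) q) = (nth 0 u p < nth 0 u q).
Proof.
move=> pu qu; rewrite !nth_std //; case: (ltnP (nth 0 u p) (nth 0 u q)) => h.
  rewrite -[X in _ < X]size_filter -[X in X < _]size_filter.
  rewrite (_ : [seq x <- u | x < nth 0 u p] =
    [seq x <- [seq x <- u | x < nth 0 u q] | x < nth 0 u p]).
    rewrite size_filter ltn_neqAle count_size andbT -all_count; apply/allPn; exists (nth 0 u p).
      by rewrite mem_filter h mem_nth.
    by rewrite ltnn.
  rewrite -filter_predI; apply: eq_filter => x /=; lia.
by apply/negbTE; rewrite -leqNgt; apply: sub_count => x /=; lia.
Qed.

(** The rank of entry [j] counts the [i] whose residue [(i + k) %% c] is below [(j + k) %% c]; as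
    the residues run through all of [0, ..., c - 1], that count is [(j + k) %% c]. *)
Lemma std_eq_cshift u c k : size u = c -> k < c ->
  (forall p q, p < c -> q < c ->
     (nth 0 u p < nth 0 u q) = ((p + k) %% c < (q + k) %% c)) ->
  std u = cshift c k.
Proof.
move=> uc kc H; apply: (@eq_from_nth _ 0); first by rewrite size_std size_cshift.
move=> j; rewrite size_std uc => jc; rewrite nth_std ?uc // nth_cshift //.
rewrite -[X in count _ X](mkseq_nth 0) uc /mkseq count_map.
rewrite (eq_in_count (a2 := preim (fun i => (i + k) %% c) (fun y => y < (j + k) %% c))).
  rewrite -count_map -/(cshift c k) (seq.permP (perm_cshift kc)) count_ltn_iota //.
  by rewrite ltnW // ltn_mod; lia.
by move=> i; rewrite mem_iota => ic /=; rewrite H.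
Qed.


(** Cyclic order seen from the least entry is linear order, so a cyclically ordered word increases
    when read cyclically from the position [p0] of its minimum. The shift is then the one sending
    [p0] to 0. *)
Lemma std_cyclicP (c : nat) (u : seq nat) : 0 < c -> size u = c -> uniq u ->
  reflect (forall p q r, p < q -> q < r -> r < c ->
             cyc3 (nth 0 u p) (nth 0 u q) (nth 0 u r))
          [exists k : 'I_c, std u == cshift c k].
Proof.
move=> c0 uc uu; apply: (iffP existsP) => [[k /eqP E] p q r pq qr rc|H].
  have lt_std i j : i < c -> j < c ->
      (nth 0 u i < nth 0 u j) = ((i + k) %% c < (j + k) %% c).
    by move=> ic jc; rewrite -nth_std_lt ?uc // E !nth_cshift.
  have kc := ltn_ord k.
  have := @cyc3_addmod c p q r k; rewrite /cyc3 !lt_std; lia.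
have [p0 _ pmin] := @arg_minnP _ (Ordinal c0) predT (fun i => nth 0 u i) isT.
have pmin' q : q < c -> q <> p0 -> nth 0 u p0 < nth 0 u q.
  move=> qc qp; have := pmin (Ordinal qc) isT; rewrite /= leq_eqVlt.
  by case/orP=> // /eqP /eqP; rewrite nth_uniq ?uc // => /eqP; lia.
have p0c := ltn_ord p0.
(* The remainder matters only for [p0 = 0], where [c - p0] would not be below [c]. *)
have kc : (c - p0) %% c < c by rewrite ltn_mod.
have kE : (c - p0) %% c = if p0 == 0 :> nat then 0 else c - p0.
  by case: eqP => [->|?]; rewrite ?subn0 ?modnn ?modn_small //; lia.
have modE p : p < c -> (p + (c - p0) %% c) %% c = if p0 <= p then p - p0 else p + c - p0.
  move=> pc; rewrite modn_add_lt // kE.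
  case: eqP => ?; case: ltnP => ?; case: leqP => ?; lia.
(* The hypothesis on [p], [q] and [p0], taken in increasing order, collapses to an inequality
   because [p0] carries the minimum. *)
have key_lt p q : p < c -> q < c ->
    (p + (c - p0) %% c) %% c < (q + (c - p0) %% c) %% c -> nth 0 u p < nth 0 u q.
  move=> pc qc; rewrite !modE //.
  have [->|/eqP pp0] := eqVneq p (p0 : nat).
    by move=> h; apply: pmin' => // qp0; rewrite qp0 ltnn in h.
  have := pmin (Ordinal qc) isT; have := pmin' p pc pp0; rewrite /= => h hq0.
  case: (leqP p0 p) => hp; case: (leqP p0 q) => hq pk.
  - have: cyc3 (nth 0 u p0) (nth 0 u p) (nth 0 u q) by apply: H => //; lia.
    by rewrite /cyc3; lia.
  - have: cyc3 (nth 0 u q) (nth 0 u p0) (nth 0 u p) by apply: H => //; lia.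
    by rewrite /cyc3; lia.
  - by lia.
  - have: cyc3 (nth 0 u p) (nth 0 u q) (nth 0 u p0) by apply: H => //; lia.
    by rewrite /cyc3; lia.
exists (Ordinal kc); apply/eqP; apply: std_eq_cshift => //= p q pc qc.
apply/idP/idP; last exact: key_lt.
move=> pq; case: ltngtP => // h.
  by have := ltn_trans pq (key_lt _ _ qc pc h); rewrite ltnn.
suff pqE : p = q by rewrite pqE ltnn in pq.
by move: h; rewrite !modE //; case: (leqP p0 p) => ?; case: (leqP p0 q) => ?; lia.
Qed.

(** * Normalization *)

Lemma size_oneline n (s : 'S_n) : size (oneline s) = n.
Proof. by rewrite size_map size_enum_ord. Qed.

Lemma nth_oneline n (s : 'S_n) (p : 'I_n) : nth 0 (oneline s) p = s p.
Proof. by rewrite (nth_map p) ?size_enum_ord // nth_ord_enum. Qed.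

Lemma uniq_oneline n (s : 'S_n) : uniq (oneline s).
Proof.
rewrite map_inj_uniq ?enum_uniq // => p q /= /val_inj; exact: perm_inj.
Qed.

(** Quantifying over cyclically ordered triples, not only increasing ones, gives a criterion that
    survives rotations of positions and values. *)
Lemma hit_atP (c n i : nat) (s : 'S_n) : 0 < c -> i + c <= n ->
  reflect (forall p q r : 'I_n, i <= p -> p < i + c -> i <= q -> q < i + c ->
             i <= r -> r < i + c -> cyc3 p q r -> cyc3 (s p) (s q) (s r))
          (hit_at c (oneline s) i).
Proof.
move=> c0 icn; rewrite /hit_at size_oneline icn /=.
set u := window c i (oneline s).
have us : size u = c by rewrite size_takel // size_drop size_oneline; lia.
have uu : uniq u by rewrite take_uniq ?drop_uniq ?uniq_oneline.
have nthu (p : 'I_n) : i <= p -> p < i + c -> nth 0 u (p - i) = s p.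
  move=> ip pic; rewrite nth_take; last by lia.
  by rewrite nth_drop subnKC // nth_oneline.
apply: (iffP (std_cyclicP c0 us uu)) => H.
  move=> p q r ip pc iq qc ir rc.
  case/or3P=> /andP[h1 h2].
  - by have := H (p - i) (q - i) (r - i); rewrite !nthu //; apply; lia.
  - have := H (q - i) (r - i) (p - i); rewrite !nthu // /cyc3 => h.
    by have := h ltac:(lia) ltac:(lia) ltac:(lia); lia.
  - have := H (r - i) (p - i) (q - i); rewrite !nthu // /cyc3 => h.
    by have := h ltac:(lia) ltac:(lia) ltac:(lia); lia.
move=> p q r pq qr rc.
have pn : i + p < n by lia.
have qn : i + q < n by lia.
have rn : i + r < n by lia.
have := H (Ordinal pn) (Ordinal qn) (Ordinal rn).
rewrite -!nthu /= ?addKn; try lia.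
by apply; rewrite /cyc3; lia.
Qed.

Definition shift n' (v : 'I_n'.+1) : 'S_n'.+1 := perm (@GRing.addIr _ v).

Lemma shiftE n' (v x : 'I_n'.+1) : shift v x = (x + v)%R.
Proof. by rewrite permE. Qed.

(** The order of a rotation divides the odd number [n'.+1], so its sign, raised to an odd power, is
    trivial. *)
Lemma odd_shift n' (v : 'I_n'.+1) : ~~ odd n' -> shift v = false :> bool.
Proof.
move=> n'odd.
have oddX k : odd_perm (shift v ^+ k)%g = odd k && shift v.
  elim: k => [|k IH]; first by rewrite expg0 odd_perm1.
  by rewrite expgS odd_permM IH /=; case: (odd k); case: odd_perm.
have sX k x : (shift v ^+ k)%g x = (x + v *+ k)%R.
  elim: k x => [|k IH] x; first by rewrite expg0 perm1 GRing.addr0.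
  by rewrite expgS permM shiftE IH GRing.mulrS GRing.addrA.
have s1 : (shift v ^+ n'.+1)%g = 1%g.
  apply/permP => x; rewrite sX perm1 Zp_mulrn.
  by rewrite [X in (x + X)%R](_ : _ = 0%R) ?GRing.addr0 //; apply: val_inj; rewrite /= modnMl.
by have := oddX n'.+1; rewrite s1 odd_perm1 /= n'odd => /esym.
Qed.

Definition inc_on n (W : pred nat) (t : 'S_n) : bool :=
  [forall p : 'I_n, forall q : 'I_n, [&& W p, W q & p < q] ==> (t p < t q)].

Lemma inc_onP n (W : pred nat) (t : 'S_n) :
  reflect (forall p q : 'I_n, W p -> W q -> p < q -> t p < t q) (inc_on W t).
Proof.
apply: (iffP forallP) => [H p q wp wq pq|H p].
  by have /forallP/(_ q) := H p; rewrite wp wq pq.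
by apply/forallP => q; apply/implyP => /and3P[]; apply: H.
Qed.

(* The windows become the sets [off]: reading positions cyclically from the
   normalized one, the window at [i] is everything outside [a+i, a+m+i). *)
Definition off (b e : nat) : pred nat := fun p => (p < b) || (e <= p).

Lemma cyc3_shift n' (v x y z : 'I_n'.+1) :
  cyc3 (x + v)%R (y + v)%R (z + v)%R = cyc3 x y z.
Proof. by rewrite cyc3_addmod. Qed.

(** Applied with [M = m], a position lying in every window [[i, i + a + m)] with [i <= m]. *)
Definition normalize n' (M : 'I_n'.+1) (s : 'S_n'.+1) : 'S_n'.+1 :=
  (shift M * s * shift (- s M)%R)%g.

Lemma normalizeE n' (M j : 'I_n'.+1) (s : 'S_n'.+1) :
  normalize M s j = (s (j + M) - s M)%R.
Proof. by rewrite !permM !shiftE. Qed.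

Lemma ord0D n' (x : 'I_n'.+1) : (ord0 + x)%R = x.
Proof. by apply: val_inj; rewrite /= add0n modn_small. Qed.

Lemma normalize0 n' (M : 'I_n'.+1) (s : 'S_n'.+1) : normalize M s ord0 = ord0.
Proof. by rewrite normalizeE ord0D GRing.subrr; apply: val_inj. Qed.

(** After normalization every window contains position 0, which carries the least value 0; relative
    to it, preserving cyclic order means preserving linear order. *)
Lemma hit_normalize (n' a m i : nat) (s : 'S_n'.+1) :
  n'.+1 = a + m.*2 -> 0 < a -> i <= m ->
  hit_at (a + m) (oneline s) i =
  inc_on (off (a + i) (a + m + i)) (normalize (inord m) s).
Proof.
move=> n'E a0 im; set M := inord m; set t := normalize M s.
have ME : M = m :> nat by rewrite inordK //; lia.
have valD (p : 'I_n'.+1) : (p + M)%R = (if p < a + m then p + m else p - (a + m)) :> nat.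
  rewrite /= ME modn_add_lt //; last by lia.
  by have := ltn_ord p; case: (ltnP (p + m)) => ?; case: (ltnP p (a + m)) => ?; lia.
have offW (p : 'I_n'.+1) : off (a + i) (a + m + i) p =
    (i <= (p + M)%R) && ((p + M)%R < i + (a + m)).
  by rewrite /off valD; have := ltn_ord p; case: (ltnP p (a + m)) => ?; lia.
have cyct (p q r : 'I_n'.+1) : cyc3 (t p) (t q) (t r) =
    cyc3 (s (p + M)%R) (s (q + M)%R) (s (r + M)%R).
  by rewrite /t !normalizeE cyc3_shift.
have t0 : t ord0 = ord0 by exact: normalize0.
apply/hit_atP/inc_onP; try lia.
  move=> H p q Wp Wq pq.
  have [p0|p0] := eqVneq p ord0.
    rewrite p0 t0 lt0n -[0]/(nat_of_ord (@ord0 n')) -t0 (inj_eq val_inj) (inj_eq perm_inj).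
    by rewrite -p0 eq_sym -(inj_eq val_inj) /=; lia.
  have p0' : 0 < p by rewrite lt0n -[0]/(nat_of_ord (@ord0 n')) (inj_eq val_inj).
  have W0 : off (a + i) (a + m + i) (@ord0 n') by rewrite /off /=; lia.
  rewrite !offW in Wp Wq W0.
  have : cyc3 (t ord0) (t p) (t q).
    case/andP: Wp => *; case/andP: Wq => *; case/andP: W0 => *.
    by rewrite cyct; apply: H => //; rewrite cyc3_shift /cyc3 /= p0' pq.
  by rewrite t0 /cyc3 /=; lia.
move=> H p q r ip pc iq qc ir rc pqr.
rewrite -[p](GRing.subrK M) -[q](GRing.subrK M) -[r](GRing.subrK M) -cyct.
rewrite -[p](GRing.subrK M) -[q](GRing.subrK M) -[r](GRing.subrK M) cyc3_shift in pqr.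
have Wp : off (a + i) (a + m + i) (p - M)%R by rewrite offW GRing.subrK ip.
have Wq : off (a + i) (a + m + i) (q - M)%R by rewrite offW GRing.subrK iq.
have Wr : off (a + i) (a + m + i) (r - M)%R by rewrite offW GRing.subrK ir.
by case/or3P: pqr => /andP[h1 h2]; rewrite /cyc3 !(H _ _ _ _ h1, H _ _ _ _ h2) ?orbT.
Qed.

(** * Counting permutations by sign *)

Definition card_sign n (P : pred 'S_n) (b : bool) : nat :=
  #|[set s : 'S_n | P s && (odd_perm s == b)]|.

Lemma card_sign_eq n (P Q : pred 'S_n) b : P =1 Q -> card_sign P b = card_sign Q b.
Proof. by move=> E; apply: eq_card => s; rewrite !inE E. Qed.

Lemma card_signID n (Q P : pred 'S_n) b :
  card_sign P b = card_sign (predI P Q) b + card_sign (predI P (predC Q)) b.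
Proof.
rewrite /card_sign -(cardsID [set s | Q s]); congr (_ + _); apply: eq_card => s.
  by rewrite !inE /= andbAC.
by rewrite !inE /= andbCA andbA.
Qed.

Lemma card_sign_invol n (P : pred 'S_n) (f : 'S_n -> 'S_n) :
  (forall s, P s -> [/\ P (f s), f (f s) = s & odd_perm (f s) = ~~ odd_perm s]) ->
  card_sign P true = card_sign P false.
Proof.
move=> H.
have le b : card_sign P b <= card_sign P (~~ b).
  rewrite /card_sign -(card_in_imset (f := f) (D := [set s | P s && (odd_perm s == b)])).
    apply: subset_leq_card; apply/subsetP => y /imsetP[s]; rewrite inE => /andP[Ps /eqP sb] ->.
    by have [Pf _ of_] := H s Ps; rewrite inE Pf of_ sb eqxx.
  move=> s t; rewrite !inE => /andP[Ps _] /andP[Pt _] E.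
  by have [_ <- _] := H s Ps; have [_ <- _] := H t Pt; rewrite E.
by apply/eqP; rewrite eqn_leq (le true) (le false).
Qed.

(** Split by the value [v] of [s] at [M]. On each of the [n'.+1] fibres normalization is
    multiplication on both sides by fixed even permutations, hence a sign-preserving bijection onto
    the [t] fixing 0. *)
Lemma card_sign_cyclic n' (M : 'I_n'.+1) (P Q : pred 'S_n'.+1) b : ~~ odd n' ->
  (forall s, P s = Q (normalize M s)) ->
  card_sign P b = n'.+1 * card_sign (fun t => (t ord0 == ord0) && Q t) b.
Proof.
move=> n'odd PQ.
have cardv v : #|[set s : 'S_n'.+1 | (P s && (odd_perm s == b)) && (s M == v)]| =
    card_sign (fun t => (t ord0 == ord0) && Q t) b.
  pose f (s : 'S_n'.+1) := (shift M * s * shift (- v)%R)%g.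
  have finj : injective f by move=> s t /mulIg /mulgI.
  rewrite /card_sign -[RHS](card_preimset _ finj); apply: eq_card => s; rewrite !inE.
  have f0 : (f s ord0 == ord0) = (s M == v).
    by rewrite !permM !shiftE ord0D -(GRing.subr_eq0 (s M)).
  rewrite f0; have [sv|] := eqVneq (s M) v; last by rewrite andbF.
  have fE : f s = normalize M s by rewrite /f /normalize sv.
  by rewrite fE -PQ !odd_permM !odd_shift // addbF andbT.
rewrite {1}/card_sign -sum1_card (partition_big (fun s : 'S_n'.+1 => s M) predT) //=.
rewrite (eq_bigr (fun=> card_sign (fun t => (t ord0 == ord0) && Q t) b)).
  by rewrite sum_nat_const card_ord.
by move=> v _; rewrite -(cardv v) -sum1_card; apply: eq_bigl => s; rewrite !inE.
Qed.

(** * Cancellation *)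

(* [n'.+1] is odd, so the nonzero values split into the pairs {2j+1, 2j+2}. *)
Definition partner n' (v : 'I_n'.+1) : 'I_n'.+1 :=
  inord (if v == 0 :> nat then 0 else if odd v then v.+1 else v.-1).

Lemma val_partner n' (v : 'I_n'.+1) : ~~ odd n' ->
  partner v = (if v == 0 :> nat then 0 else if odd v then v.+1 else v.-1) :> nat.
Proof.
move=> n'odd; rewrite inordK //; have := ltn_ord v.
by case: eqP => // ?; case: ifP => ?; lia.
Qed.

Lemma partnerK n' : ~~ odd n' -> involutive (@partner n').
Proof.
move=> n'odd v; apply: val_inj; rewrite /= !val_partner //.
case: (posnP v) => [v0 //|v0].
case: (boolP (odd v)) => ov; first by rewrite /= ov.
by case: eqP => ?; [lia | rewrite ifT; lia].
Qed.

Lemma partner_neq0 n' (v : 'I_n'.+1) : ~~ odd n' -> (partner v == ord0) = (v == ord0).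
Proof.
move=> n'odd; rewrite -!(inj_eq val_inj) /= val_partner //.
by case: (posnP v) => [//|?]; case: ifP => ?; lia.
Qed.

Lemma partner_neq n' (v : 'I_n'.+1) : ~~ odd n' -> v != ord0 -> v != partner v.
Proof.
move=> n'odd; rewrite -!(inj_eq val_inj) /= val_partner //.
by case: (posnP v) => // ? _; case: ifP => ?; lia.
Qed.

(** Nonzero partners are consecutive, so no third value lies between them and only their mutual
    order changes. *)
Lemma tperm_partner_lt n' (v x y : 'I_n'.+1) : ~~ odd n' ->
  (x, y) != (v, partner v) -> (x, y) != (partner v, v) ->
  (tperm v (partner v) x < tperm v (partner v) y) = (x < y).
Proof.
move=> n'odd; rewrite !xpair_eqE -!(inj_eq val_inj) /=.
have pE := val_partner v n'odd.
case: tpermP => [->|->|/eqP xv /eqP xp]; case: tpermP => [->|->|/eqP yv /eqP yp] //=;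
  do ?[move: xv xp; rewrite -!(inj_eq val_inj) /=];
  do ?[move: yv yp; rewrite -!(inj_eq val_inj) /=];
  rewrite ?pE; case: (posnP v) => ?; try case: (boolP (odd v)) => ?; lia.
Qed.

Definition swap_value n' (v : 'I_n'.+1) (t : 'S_n'.+1) : 'S_n'.+1 :=
  (t * tperm v (partner v))%g.

Lemma inc_on_swap n' (W : pred nat) (v q : 'I_n'.+1) (t : 'S_n'.+1) : ~~ odd n' ->
  ~~ W q -> inc_on W (swap_value (t q) t) = inc_on W t.
Proof.
move=> n'odd Wq; apply: eq_forallb => x; apply: eq_forallb => y.
case: (boolP (W x)) => //= Wx; case: (boolP (W y)) => //= Wy.
rewrite !permM tperm_partner_lt // xpair_eqE !(inj_eq perm_inj).
  by apply: contra Wq => /andP[/eqP <-].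
by apply: contra Wq => /andP[_ /eqP <-].
Qed.

(* If [P] ignores what stands at position [q], exchanging the value there with
   its partner is a sign-reversing involution. *)
Lemma card_sign_free n' (q : 'I_n'.+1) (P : pred 'S_n'.+1) : ~~ odd n' -> q != ord0 ->
  (forall t : 'S_n'.+1, P (swap_value (t q) t) = P t) ->
  card_sign (fun t : 'S_n'.+1 => (t ord0 == ord0) && P t) true =
  card_sign (fun t : 'S_n'.+1 => (t ord0 == ord0) && P t) false.
Proof.
move=> n'odd q0 Pswap; apply: (card_sign_invol (f := fun t : 'S_n'.+1 => swap_value (t q) t)).
move=> t /andP[/eqP t0 Pt].
have tq0 : t q != ord0 by rewrite -t0 (inj_eq perm_inj).
split.
- rewrite Pswap Pt andbT permM t0 tpermD //.
  by rewrite partner_neq0.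
- have -> : swap_value (t q) t q = partner (t q) by rewrite permM tpermL.
  by rewrite /swap_value partnerK // tpermC -mulgA tperm2 mulg1.
- by rewrite odd_permM odd_tperm partner_neq // addbT.
Qed.

Lemma nonavoider_normalize (n' a m : nat) (s : 'S_n'.+1) :
  n'.+1 = a + m.*2 -> 0 < a ->
  nonavoider (a + m) s =
  has (fun i => inc_on (off (a + i) (a + m + i)) (normalize (inord m) s)) (iota 0 m.+1).
Proof.
move=> n'E a0; apply/existsP/hasP => [[i hi]|[i]].
  have im : i <= m by move: hi; rewrite /hit_at size_oneline => /andP[]; lia.
  by exists (i : nat); [rewrite mem_iota; lia | rewrite -hit_normalize].
rewrite mem_iota add0n ltnS => /andP[_ im] hi.
have ilt : i < n'.+2 by lia.
by exists (Ordinal ilt); rewrite (@hit_normalize _ a m).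
Qed.

(** The blocks left out by the two extreme windows, [[a, a + m)] and [[a + m, a + 2m)], are
    disjoint, so no position is free for both. *)
Definition extremal_hits n (a m : nat) (t : 'S_n) : bool :=
  [&& inc_on (off a (a + m)) t, inc_on (off (a + m) (a + m + m)) t &
      ~~ has (fun i => inc_on (off (a + i) (a + m + i)) t) (iota 1 m.-1)].

(** In terms of odd minus even counts: a hit at some window is a hit before [m], or a hit at [m]
    with none before. The first kind balances; since all hits at [m] balance too, the second
    contributes the negative of hits at [m] with an earlier one, which reduce to [extremal_hits].
    The negative contribution is moved across the equation. *)
Lemma card_sign_nonavoider (n' a m : nat) : n'.+1 = a + m.*2 -> 0 < a -> 0 < m ->
  ~~ odd n' ->
  card_sign (@nonavoider (a + m) n'.+1) true +
    n'.+1 * card_sign (fun t : 'S_n'.+1 => (t ord0 == ord0) && extremal_hits a m t) true =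
  card_sign (@nonavoider (a + m) n'.+1) false +
    n'.+1 * card_sign (fun t : 'S_n'.+1 => (t ord0 == ord0) && extremal_hits a m t) false.
Proof.
move=> n'E a0 m0 n'odd.
pose h i (t : 'S_n'.+1) := inc_on (off (a + i) (a + m + i)) t.
pose hs s (t : 'S_n'.+1) := has (h^~ t) s.
pose C Q b := card_sign (fun t : 'S_n'.+1 => (t ord0 == ord0) && Q t) b.
have cyc b : card_sign (@nonavoider (a + m) n'.+1) b = n'.+1 * C (hs (iota 0 m.+1)) b.
  apply: (card_sign_cyclic (M := inord m)) => // s.
  exact: nonavoider_normalize.
rewrite !cyc -![card_sign _ _]/(C _ _) -!mulnDr; congr (_ * _).
have CID Q R b : C Q b = C (predI Q R) b + C (predI Q (predC R)) b.
  rewrite /C (card_signID R); congr (_ + _); apply: card_sign_eq => t /=;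
  by rewrite andbA.
have Ceq Q R b : Q =1 R -> C Q b = C R b.
  by move=> QR; apply: card_sign_eq => t; rewrite QR.
(* A window avoids position [x] when [a + i <= x < a + m + i]; any family of
   windows other than one containing both extreme ones leaves some [x] free. *)
have free (x : nat) Q : 0 < x -> x < n'.+1 ->
    (forall (t : 'S_n'.+1) (q : 'I_n'.+1), q = x :> nat -> Q (swap_value (t q) t) = Q t) ->
    C Q true = C Q false.
  move=> x0 xn HQ; apply: (@card_sign_free _ (inord x)) => //.
    by rewrite -(inj_eq val_inj) /= inordK //; lia.
  by move=> t; apply: HQ; rewrite inordK.
have hfree i (x : nat) (t : 'S_n'.+1) (q : 'I_n'.+1) :
    q = x :> nat -> a + i <= x -> x < a + m + i ->
    h i (swap_value (t q) t) = h i t.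
  by move=> qx h1 h2; apply: inc_on_swap => //; rewrite qx /off; lia.
have hsfree s (x : nat) (t : 'S_n'.+1) (q : 'I_n'.+1) : q = x :> nat ->
    (forall i, i \in s -> (a + i <= x) && (x < a + m + i)) ->
    hs s (swap_value (t q) t) = hs s t.
  by move=> qx H; apply: eq_in_has => i /H /andP[h1 h2]; apply: hfree qx h1 h2.
have iotaS : iota 0 m.+1 = iota 0 m ++ [:: m] by rewrite -addn1 iotaD.
have A b : C (hs (iota 0 m.+1)) b = C (hs (iota 0 m)) b + C (predI (h m) (predC (hs (iota 0 m)))) b.
  rewrite iotaS (CID _ (hs (iota 0 m))); congr (_ + _); apply: Ceq => t;
    rewrite /= /hs has_cat /= orbF; case: (has _ _); by case: (h m t).
have B b : C (h m) b = C (predI (h m) (hs (iota 0 m))) b +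
    C (predI (h m) (predC (hs (iota 0 m)))) b by exact: CID.
have hs0 t : hs (iota 0 m) t = h 0 t || hs (iota 1 m.-1) t.
  by rewrite /hs -{1}(prednK m0).
have exE t : extremal_hits a m t = [&& h 0 t, h m t & ~~ hs (iota 1 m.-1) t].
  by rewrite /extremal_hits /h !addn0.
have D b : C (predI (h m) (hs (iota 0 m))) b =
    C (predI (h m) (hs (iota 1 m.-1))) b + C (extremal_hits a m) b.
  rewrite (CID _ (hs (iota 1 m.-1))); congr (_ + _); apply: Ceq => t;
    rewrite /= ?exE hs0;
    by case: (hs _ t); case: (h 0 t); case: (h m t).
(* Position [a + m - 1] is outside all windows [0, ..., m - 1]; in the next two steps position
   [a + m] is outside all windows [1, ..., m]. *)
have F1 : C (hs (iota 0 m)) true = C (hs (iota 0 m)) false.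
  apply: (free (a + m).-1); try lia.
  by move=> t q qE; apply: hsfree qE _ => i; rewrite mem_iota; lia.
have F2 : C (h m) true = C (h m) false.
  apply: (free (a + m)); try lia.
  by move=> t q qE; apply: hfree qE _ _; lia.
have F3 : C (predI (h m) (hs (iota 1 m.-1))) true = C (predI (h m) (hs (iota 1 m.-1))) false.
  apply: (free (a + m)); try lia.
  move=> t q qE /=; rewrite (hfree _ _ _ _ qE) ?(hsfree _ _ _ _ qE) //; try lia.
  by move=> i; rewrite mem_iota; lia.
have := A true; have := A false; have := B true; have := B false.
by have := D true; have := D false; lia.
Qed.

(** * Shuffles and lattice paths *)

(** As [v] grows this counts the up-steps of the lattice path that steps up at each value standing
    at a position at least [c]. *)
Definition high n (c : nat) (t : 'S_n) (v : nat) : nat :=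
  #|[set p : 'I_n | (c <= p) && (t p < v)]|.

Lemma card_ord_ltn n e : e <= n -> #|[set p : 'I_n | p < e]| = e.
Proof.
move=> en; rewrite cardsE -sum1_card -(big_ord_widen n (fun=> 1) en).
by rewrite sum1_card card_ord.
Qed.

Lemma card_ord_interval n b e : b <= e -> e <= n ->
  #|[set p : 'I_n | b <= p < e]| = e - b.
Proof.
move=> be en; rewrite -[in RHS](card_ord_ltn en).
rewrite -(cardsID [set p : 'I_n | p < b] [set p : 'I_n | p < e]).
rewrite (_ : _ :&: _ = [set p : 'I_n | p < b]); last first.
  by apply/setP => p; rewrite !inE; lia.
rewrite card_ord_ltn ?addKn; last by lia.
by apply: eq_card => p; rewrite !inE; lia.
Qed.

Lemma card_low n c (t : 'S_n) v : v <= n ->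
  #|[set p : 'I_n | (p < c) && (t p < v)]| = v - high c t v.
Proof.
move=> vn; have := card_ord_ltn vn; rewrite -(card_preimset _ (@perm_inj _ t)).
rewrite -(cardsID [set p : 'I_n | c <= p] (t @^-1: _)).
rewrite (_ : #|_ :&: _| = high c t v); last first.
  by apply: eq_card => p; rewrite !inE andbC.
rewrite (_ : #|_ :\: _| = #|[set p : 'I_n | (p < c) && (t p < v)]|); first by lia.
by apply: eq_card => p; rewrite !inE -ltnNge.
Qed.

Lemma high_le n c (t : 'S_n) v : v <= n -> high c t v <= v.
Proof.
move=> vn; rewrite -[X in _ <= X](card_ord_ltn vn) -(card_preimset _ (@perm_inj _ t)).
by apply/subset_leq_card/subsetP => p; rewrite !inE => /andP[].
Qed.

Lemma high_homo n c (t : 'S_n) : {homo high c t : v w / v <= w}.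
Proof.
move=> v w vw; apply/subset_leq_card/subsetP => p; rewrite !inE => /andP[-> h] /=.
exact: leq_trans vw.
Qed.

Lemma high_total n c (t : 'S_n) : c <= n -> high c t n = n - c.
Proof.
move=> cn; rewrite -(@card_ord_interval n c n) //; apply: eq_card => p.
by rewrite !inE !ltn_ord.
Qed.

Lemma highS n c (t : 'S_n) (v : 'I_n) :
  high c t v.+1 = (c <= (t^-1)%g v) + high c t v.
Proof.
rewrite /high (cardsD1 ((t^-1)%g v)) !inE permKV ltnSn andbT; congr (_ + _).
apply: eq_card => p; rewrite !inE ltnS (leq_eqVlt _ v) (inj_eq val_inj).
rewrite -(can2_eq (permK t) (permKV t)).
by case: eqP => [->|] /=; rewrite ?ltnn ?andbF.
Qed.

Definition two_runs n (c : nat) (t : 'S_n) : Prop :=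
  (forall p q : 'I_n, p < q -> q < c -> t p < t q) /\
  (forall p q : 'I_n, c <= p -> p < q -> t p < t q).

(** The values below [v] fill an initial segment of the upper run, whose length is [high c t v]; the
    lower run is treated likewise, with length [v - high c t v]. *)
Lemma two_runs_high n c (t : 'S_n) (p : 'I_n) v : two_runs c t -> v <= n ->
  c <= p -> (t p < v) = (p < c + high c t v).
Proof.
move=> [_ iH] vn cp; have pn := ltn_ord p; apply/idP/idP => h.
  suff : p.+1 - c <= high c t v by lia.
  rewrite -(@card_ord_interval n c p.+1) //; last by lia.
  apply/subset_leq_card/subsetP => q; rewrite !inE ltnS => /andP[cq qp].
  rewrite cq; move: qp; rewrite leq_eqVlt => /orP[/eqP/val_inj ->//|qp].
  by apply: leq_trans h; rewrite ltnW // ltnS iH.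
rewrite ltnNge; apply/negP => h2.
suff : high c t v <= p - c by lia.
rewrite -(@card_ord_interval n c p) //; last by lia.
apply/subset_leq_card/subsetP => q; rewrite !inE => /andP[cq qv].
rewrite cq ltnNge leq_eqVlt; apply/negP => /orP[/eqP/val_inj pq|pq].
  by rewrite -pq in qv; lia.
by have := iH _ _ cp pq; lia.
Qed.

Lemma two_runs_low n c (t : 'S_n) (p : 'I_n) v : two_runs c t -> v <= n ->
  p < c -> (t p < v) = (p + high c t v < v).
Proof.
move=> [iL _] vn cp; have pn := ltn_ord p; have hv := high_le c t vn.
apply/idP/idP => h.
  suff : p.+1 <= v - high c t v by lia.
  rewrite -card_low // -[p.+1](card_ord_ltn (n := n)) //.
  apply/subset_leq_card/subsetP => q; rewrite !inE ltnS => qp.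
  rewrite (leq_ltn_trans qp cp); move: qp; rewrite leq_eqVlt => /orP[/eqP/val_inj ->//|qp].
  by apply: leq_trans h; rewrite ltnW // ltnS iL.
rewrite ltnNge; apply/negP => h2.
suff : v - high c t v <= p by lia.
rewrite -card_low // -[X in _ <= X](card_ord_ltn (n := n)); last by lia.
apply/subset_leq_card/subsetP => q; rewrite !inE => /andP[cq qv].
rewrite ltnNge leq_eqVlt; apply/negP => /orP[/eqP/val_inj pq|pq].
  by rewrite -pq in qv; lia.
by have := iL _ _ pq cq; lia.
Qed.

(** Each value is preceded in its run exactly by the smaller values of that run. Thus the path
    determines the permutation. *)
Lemma two_runs_pos n c (t : 'S_n) (v : 'I_n) : two_runs c t ->
  (t^-1)%g v = (if c <= (t^-1)%g v then c + high c t v else v - high c t v) :> nat.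
Proof.
move=> tt; have vn := ltn_ord v; have hS := highS c t v; have hv := high_le c t (ltnW vn).
case: leqP hS => cp hS.
  have := two_runs_high tt (ltnW vn) cp; have := two_runs_high tt vn cp.
  by rewrite permKV ltnn ltnSn hS; lia.
have := two_runs_low tt (ltnW vn) cp; have := two_runs_low tt vn cp.
by rewrite permKV ltnn ltnSn hS; lia.
Qed.

(* Reading [t^-1] as a word in the letters "position below a+m" and "position
   above", the last condition says that the lattice path of its letters from
   [a] on stays strictly positive until its end. *)
Definition prime_shuffle n (a m : nat) (t : 'S_n) : Prop :=
  [/\ two_runs (a + m) t, high (a + m) t a = 0 &
      forall v, a < v -> v < n -> v < (high (a + m) t v).*2 + a].

Lemma prime_shuffle0 n' a m (t : 'S_n'.+1) : 0 < a -> prime_shuffle a m t -> t ord0 = ord0.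
Proof.
move=> a0 [[iL _] h0 _].
pose p := (t^-1)%g ord0; have tp : t p = ord0 by rewrite permKV.
have pc : p < a + m.
  rewrite ltnNge; apply/negP => cp.
  move: h0; rewrite /high => /eqP; rewrite cards_eq0 => /eqP/setP/(_ p).
  by rewrite !inE cp tp a0.
have [p0|p0] := posnP p; first by rewrite -[RHS]tp; congr (t _); apply: val_inj.
by have := @iL ord0 p p0 pc; rewrite tp.
Qed.

(** The hits at [0] and [m] give the two runs and [high (a + m) t a = 0]. Given these, a hit at [i]
    amounts to [t (a + i - 1) < t (a + m + i)], which happens for some [0 < i < m] exactly when the
    path fails to be positive somewhere. *)
Lemma extremal_hitsP n' a m (t : 'S_n'.+1) : n'.+1 = a + m.*2 -> 0 < a -> 1 < m ->
  reflect (prime_shuffle a m t) ((t ord0 == ord0) && extremal_hits a m t).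
Proof.
move=> nE a0 m1; apply: (iffP andP) => [[_ /and3P[/inc_onP i0 /inc_onP im /hasPn nh]]|E].
  have tt : two_runs (a + m) t.
    split=> p q h1 h2; first by apply: im => //; rewrite /off; lia.
    by apply: i0 => //; rewrite /off; lia.
  have ha : high (a + m) t a = 0.
    apply/eqP; rewrite cards_eq0; apply/eqP/setP => p; rewrite !inE; apply/negP => /andP[cp tpa].
    (* An upper value below [a] would exceed the values at all [a] first positions, giving more than
       [a] values below [a]. *)
    suff : a <= #|[set q : 'I_n'.+1 | (q < a + m) && (t q < a)]|.
      rewrite card_low; last by lia.
      suff : 0 < high (a + m) t a by lia.
      by rewrite card_gt0; apply/set0Pn; exists p; rewrite inE cp.
    rewrite -{1}[a](card_ord_ltn (n := n'.+1)); last by lia.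
    apply/subset_leq_card/subsetP => q; rewrite !inE => qa.
    rewrite ltn_addr //=; apply: ltn_trans tpa; apply: i0; rewrite /off; lia.
  split=> // v av vn; rewrite ltnNge; apply/negP => hv.
  (* A failure at [v] with [k] up-steps produces a hit at [k]; for [k = 0] the index 1 serves, since
     [a < v]. *)
  set k := high _ _ _ in hv; pose i := maxn k 1.
  have /nh : i \in iota 1 m.-1 by rewrite mem_iota /i; lia.
  apply/negP; rewrite negbK; apply/inc_onP => p q Wp Wq pq.
  have [qc|cq] := ltnP q (a + m); first exact: tt.1.
  have [cp|pc] := leqP (a + m) p; first exact: tt.2.
  apply: (@leq_trans v).
    rewrite (two_runs_low tt (ltnW vn) pc) -/k; move: Wp; rewrite /off /i; lia.
  by rewrite leqNgt (two_runs_high tt (ltnW vn) cq) -/k; move: Wq; rewrite /off /i; lia.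
split; first by rewrite (prime_shuffle0 a0 E).
case: E => tt h0 H; apply/and3P; split.
- apply/inc_onP => p q Wp Wq pq.
  have [qc|cq] := ltnP q (a + m); first exact: tt.1.
  have [cp|pc] := leqP (a + m) p; first exact: tt.2.
  have an : a <= n'.+1 by lia.
  apply: (@leq_trans a).
    by rewrite (two_runs_low tt an pc) h0; move: Wp; rewrite /off; lia.
  by rewrite leqNgt (two_runs_high tt an cq) h0; lia.
- apply/inc_onP => p q Wp Wq pq; apply: tt.1 => //.
  by have := ltn_ord q; move: Wq; rewrite /off; lia.
apply/hasPn => i; rewrite mem_iota => im; apply/negP => /inc_onP hi.
(* These are the last position before the omitted block and the first one after it; the path fails
   at the value of the latter. *)
have pn : (a + i).-1 < n'.+1 by lia.
have qn : a + m + i < n'.+1 by lia.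
have := hi (Ordinal pn) (Ordinal qn); rewrite /off /=.
move=> /(_ ltac:(lia) ltac:(lia) ltac:(lia)).
set p := Ordinal pn; set q := Ordinal qn => pq.
have vn := ltn_ord (t q).
have pc : p < a + m by rewrite /=; lia.
have cq : a + m <= q by rewrite /=; lia.
have := two_runs_low tt (ltnW vn) pc; have := two_runs_high tt (ltnW vn) cq.
have := H (t q); rewrite pq ltnn /=; lia.
Qed.

(** * Pairing the steps *)

Lemma odd_complement n' a m : n'.+1 = a + m.*2 -> odd a -> ~~ odd n'.
Proof. by lia. Qed.

Definition mixed n' c (t : 'S_n'.+1) (v : 'I_n'.+1) : bool :=
  (c <= (t^-1)%g v) != (c <= (t^-1)%g (partner v)).

Lemma swap_valueV n' (v u : 'I_n'.+1) (t : 'S_n'.+1) :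
  ((swap_value v t)^-1)%g u = (t^-1)%g (tperm v (partner v) u).
Proof. by rewrite /swap_value invMg tpermV permM. Qed.

Lemma swap_value_partner n' (v : 'I_n'.+1) (t : 'S_n'.+1) : ~~ odd n' ->
  swap_value (partner v) t = swap_value v t.
Proof. by move=> n'odd; rewrite /swap_value partnerK // tpermC. Qed.

Lemma swap_valueK n' (v : 'I_n'.+1) : involutive (@swap_value n' v).
Proof. by move=> t; rewrite /swap_value -mulgA tperm2 mulg1. Qed.

Lemma mixed_partner n' c (t : 'S_n'.+1) (v : 'I_n'.+1) : ~~ odd n' ->
  mixed c t (partner v) = mixed c t v.
Proof. by move=> n'odd; rewrite /mixed partnerK // eq_sym. Qed.

Lemma mixed_neq0 n' c (t : 'S_n'.+1) (v : 'I_n'.+1) : ~~ odd n' ->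
  mixed c t v -> v != ord0.
Proof.
move=> n'odd; apply: contraTneq => ->; rewrite /mixed.
have /eqP -> : partner (@ord0 n') == ord0 by rewrite partner_neq0.
by rewrite eqxx.
Qed.

Lemma mixed_swap n' c (t : 'S_n'.+1) (v u : 'I_n'.+1) : ~~ odd n' ->
  mixed c (swap_value v t) u = mixed c t u.
Proof.
move=> n'odd; rewrite /mixed !swap_valueV.
case: (tpermP _ _ u) => [->|->|uv uv']; first by rewrite tpermR eq_sym.
  by rewrite partnerK // tpermL eq_sym.
rewrite tpermD //; apply/eqP => E; first by apply: uv'; rewrite E partnerK.
by apply: uv; apply: (can_inj (partnerK n'odd)).
Qed.

(** The exchange reverses only the order of [v] and its partner, which stand in different runs. *)
Lemma two_runs_swap n' c (t : 'S_n'.+1) (v : 'I_n'.+1) : ~~ odd n' ->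
  mixed c t v -> two_runs c t -> two_runs c (swap_value v t).
Proof.
move=> n'odd mv [iL iH].
have key (p q : 'I_n'.+1) : (c <= p) = (c <= q) -> t p < t q ->
    swap_value v t p < swap_value v t q.
  move=> pq tpq; rewrite !permM tperm_partner_lt // xpair_eqE.
    by apply: contraTN mv => /andP[/eqP E1 /eqP E2]; rewrite /mixed -E2 -E1 !permK negbK pq.
  by apply: contraTN mv => /andP[/eqP E1 /eqP E2]; rewrite /mixed -E1 -E2 !permK negbK pq.
split=> p q h1 h2; apply: key; [lia | exact: iL | lia | exact: iH].
Qed.

(** The exchanged values are [v] and [v + 1]; only the threshold [v + 1] separates them. *)
Lemma high_swap n' c (t : 'S_n'.+1) (v : 'I_n'.+1) u : ~~ odd n' -> odd v -> u != v.+1 ->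
  high c (swap_value v t) u = high c t u.
Proof.
move=> n'odd ov uv; apply: eq_card => p; rewrite !inE permM; congr (_ && _).
have pE := val_partner v n'odd; rewrite ov gtn_eqF ?odd_gt0 // in pE.
case: tpermP => [->|->|//]; rewrite pE; lia.
Qed.

(** For odd [v] only the height after the first step of the pair can change. Before the pair the
    height is even, as [a] is odd; if [v > a] it is positive, hence at least 2, and one step leaves
    it positive. *)
Lemma prime_shuffle_swap n' a m (t : 'S_n'.+1) (v : 'I_n'.+1) :
  n'.+1 = a + m.*2 -> odd a -> 1 < m -> mixed (a + m) t v ->
  prime_shuffle a m t -> prime_shuffle a m (swap_value v t).
Proof.
move=> nE ao m1; have n'odd := odd_complement nE ao.
wlog ov : v / odd v => [wl mv E|].
  have [ov|ev] := boolP (odd v); first exact: wl.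
  rewrite -swap_value_partner //; apply: wl; rewrite ?mixed_partner //.
  have := mixed_neq0 n'odd mv; rewrite -(inj_eq val_inj) /= val_partner // => v0.
  by rewrite (negbTE v0) (negbTE ev); lia.
move=> mv [tt h0 H]; split; first exact: two_runs_swap.
  by rewrite high_swap //; lia.
move=> u au un; have [uv|uv] := eqVneq u v.+1; last by rewrite high_swap // H.
have pE := val_partner v n'odd; rewrite ov gtn_eqF ?odd_gt0 // in pE.
have va : a <= v by lia.
(* Strict positivity at [a + 1] and [a + 2] forces the first two steps up, so that pair is not
   mixed. *)
have va' : v != a :> nat.
  apply/eqP => vaE.
  have S1 := highS (a + m) t v; have S2 := highS (a + m) t (partner v).
  have H1 := H v.+1; have H2 := H v.+2.
  move: mv; rewrite /mixed; rewrite pE in S2; move: S1 S2 H1 H2; rewrite vaE h0.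
  by case: leqP => _; case: leqP => _; lia.
have hS := high_homo (a + m) (swap_value v t) (leqnSn v).
rewrite (@high_swap _ _ _ _ v) // in hS; last by lia.
by have := H v; rewrite uv; lia.
Qed.

(* Such an [r] is the product of a permutation of the odd values and its
   conjugate on the nonzero even ones. *)
Lemma odd_perm_doubled n' (r : 'S_n'.+1) : ~~ odd n' -> r ord0 = ord0 ->
  (forall v : 'I_n'.+1, odd v -> odd (r v) && (r (partner v) == partner (r v))) ->
  odd_perm r = false.
Proof.
move=> n'odd r0 H.
have oddp (v : 'I_n'.+1) : v != ord0 -> odd (partner v) = ~~ odd v.
  rewrite -(inj_eq val_inj) val_partner //=.
  by case: (posnP v) => // ? _; case: ifP => ?; lia.
pose g (x : 'I_n'.+1) := if odd x then r x else x.
have ginj : injective g.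
  move=> x y; rewrite /g; case: ifP => ox; case: ifP => oy //; first exact: perm_inj.
    by move=> E; have /andP[] := H x ox; rewrite E oy.
  by move=> E; have /andP[] := H y oy; rewrite -E ox.
pose u := perm ginj.
pose pi := perm (can_inj (partnerK n'odd)).
have piV x : (pi^-1)%g x = partner x.
  by apply: (@perm_inj _ pi); rewrite permKV permE partnerK.
suff -> : r = (u * u ^ pi)%g by rewrite odd_permM odd_permJ addbb.
apply/permP => x; rewrite conjgE !permM piV !permE /g.
have [->|x0] := eqVneq x ord0.
  rewrite /=; have /eqP -> : partner (@ord0 n') == ord0 by rewrite partner_neq0.
  by rewrite r0; apply/esym/eqP; rewrite partner_neq0.
case: (boolP (odd x)) => ox.
  have /andP[orx _] := H x ox; rewrite oddp ?orx ?partnerK //.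
  by apply: contraTneq orx => ->.
rewrite oddp // ox; have := H (partner x).
by rewrite oddp // ox partnerK // => /(_ isT)/andP[_ /eqP ->].
Qed.

(** Over each pair [high] grows by 0 or 2, so it is even at odd values. As [a + m] is odd,
    [two_runs_pos] shows that the inverse of [t] sends odd values to odd positions and partners to
    partners. *)
Lemma unmixed_even n' a m (t : 'S_n'.+1) :
  n'.+1 = a + m.*2 -> odd a -> ~~ odd m -> 1 < m -> prime_shuffle a m t ->
  (forall v, ~~ mixed (a + m) t v) -> odd_perm t = false.
Proof.
move=> nE ao me m1 E um.
have n'odd := odd_complement nE ao.
have a0 : 0 < a by rewrite odd_gt0.
have t0 := prime_shuffle0 a0 E; case: E => tt h0 H.
have tV0 : (t^-1)%g ord0 = ord0 by rewrite -{1}t0 permK.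
pose hi := high (a + m) t.
have partE (v : 'I_n'.+1) : odd v -> partner v = v.+1 :> nat.
  by move=> ov; rewrite val_partner // ov gtn_eqF ?odd_gt0.
have WE (v : 'I_n'.+1) : (a + m <= (t^-1)%g (partner v)) = (a + m <= (t^-1)%g v).
  by have := um v; rewrite /mixed negbK => /eqP.
have hodd k : k.*2.+1 <= n'.+1 -> ~~ odd (hi k.*2.+1).
  elim: k => [|k IH] kn.
    rewrite /hi (highS _ _ ord0) tV0 leqNgt ltn_addr //=.
    by have := high_le (a + m) t (leq0n n'.+1); rewrite leqn0 => /eqP ->.
  have k1 : k.*2.+1 < n'.+1 by lia.
  pose v := Ordinal k1; have ov : odd v by rewrite /= odd_double.
  have S1 := highS (a + m) t v; have := highS (a + m) t (partner v).
  rewrite partE // WE S1 doubleS /hi /= => ->.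
  by rewrite addnA addnn oddD odd_double IH // ltnW.
rewrite -odd_permV; apply: odd_perm_doubled => // v ov.
have vn := ltn_ord v; have hv : ~~ odd (hi v).
  have -> : v = (v : nat)./2.*2.+1 :> nat by have := odd_double_half v; rewrite ov; lia.
  by apply: hodd; lia.
have P1 := two_runs_pos v tt; have P2 := two_runs_pos (partner v) tt.
have S1 := highS (a + m) t v; have hl := high_le (a + m) t (ltnW vn).
rewrite WE partE // S1 in P2; rewrite /hi in hv.
have rv : odd ((t^-1)%g v).
  by rewrite P1; case: leqP => ?; lia.
rewrite rv -(inj_eq val_inj) /= partE // P1 P2; case: leqP => ?; lia.
Qed.

Lemma card_sign_prime_shuffle n' a m :
  n'.+1 = a + m.*2 -> odd a -> ~~ odd m -> 1 < m ->
  card_sign (fun t : 'S_n'.+1 => (t ord0 == ord0) && extremal_hits a m t) false =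
  card_sign (fun t : 'S_n'.+1 => (t ord0 == ord0) && extremal_hits a m t) true +
  #|[set t : 'S_n'.+1 | ((t ord0 == ord0) && extremal_hits a m t) &&
       [forall v, ~~ mixed (a + m) t v]]|.
Proof.
move=> nE ao me m1.
have n'odd := odd_complement nE ao.
have a0 : 0 < a by rewrite odd_gt0.
set E := fun t : 'S_n'.+1 => _ && _.
have EP (t : 'S_n'.+1) : reflect (prime_shuffle a m t) (E t) by exact: extremal_hitsP.
pose F (t : 'S_n'.+1) := [forall v, ~~ mixed (a + m) t v].
rewrite !(card_signID F E).
have -> : card_sign (predI E F) true = 0.
  apply: eq_card0 => t; rewrite !inE /=; apply/negP => /andP[/andP[/EP Et /forallP Ft]].
  by rewrite (unmixed_even nE).
have -> : card_sign (predI E F) false = #|[set t | E t && F t]|.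
  apply: eq_card => t; rewrite !inE /=; case: (boolP (E t)) => //= /EP Et.
  by case: (boolP (F t)) => //= /forallP Ft; rewrite (unmixed_even nE).
suff -> : card_sign (predI E (predC F)) true = card_sign (predI E (predC F)) false.
  by rewrite add0n addnC.
pose f (t : 'S_n'.+1) := if [pick v | mixed (a + m) t v] is Some v then swap_value v t else t.
apply: (card_sign_invol (f := f)) => t /andP[/EP Et /=]; rewrite /F negb_forall => /existsP[v0].
rewrite negbK => mv0; rewrite /f.
case pk: [pick v | _] => [v|]; last by move: pk; case: pickP => // /(_ v0); rewrite mv0.
have mv : mixed (a + m) t v by move: pk; case: pickP => // w ? [<-].
(* Mixedness is unchanged by the exchange, so [pick] selects the same value again and [f] is an
   involution. *)
rewrite (eq_pick (Q := mixed (a + m) t)) ?pk; last by move=> u; exact: mixed_swap.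
split; last 2 first.
- exact: swap_valueK.
- by rewrite odd_permM odd_tperm partner_neq ?(mixed_neq0 n'odd mv) // addbT.
apply/andP; split; first by apply/EP/prime_shuffle_swap.
by rewrite /= negb_forall; apply/existsP; exists v; rewrite negbK mixed_swap.
Qed.

(** * Dyck words *)

Lemma count_iotaS (W : pred nat) v : count W (iota 0 v.+1) = count W (iota 0 v) + W v.
Proof. by rewrite -addn1 iotaD count_cat /= addn0. Qed.

Lemma count_iotaD (W : pred nat) u v : u <= v ->
  count W (iota 0 u) <= count W (iota 0 v) <= count W (iota 0 u) + (v - u).
Proof.
move=> uv; rewrite -{1 2}(subnKC uv) iotaD count_cat leq_addr leq_add2l /=.
by rewrite (leq_trans (count_size _ _)) // size_iota.
Qed.

Lemma high_count n c (t : 'S_n) (W : pred nat) :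
  (forall v : 'I_n, (c <= (t^-1)%g v) = W v) ->
  forall v, v <= n -> high c t v = count W (iota 0 v).
Proof.
move=> HW; elim=> [|v IH] vn.
  by apply/eqP; rewrite cards_eq0; apply/eqP/setP => p; rewrite !inE andbF.
by rewrite (highS c t (Ordinal vn)) HW count_iotaS addnC IH // ltnW.
Qed.

Lemma two_runs_inj n c (t1 t2 : 'S_n) : two_runs c t1 -> two_runs c t2 ->
  (forall v : 'I_n, (c <= (t1^-1)%g v) = (c <= (t2^-1)%g v)) -> t1 = t2.
Proof.
move=> tt1 tt2 E; apply: invg_inj; apply/permP => v; apply: val_inj; rewrite /=.
(* The step pattern is extended from ordinals to naturals so that heights become counts over
   [iota]. *)
pose W (k : nat) := [exists u : 'I_n, (u == k :> nat) && (c <= (t2^-1)%g u)].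
have W2 (u : 'I_n) : (c <= (t2^-1)%g u) = W u.
  apply/idP/existsP => [h|[w /andP[/eqP/val_inj <-]]//].
  by exists u; rewrite eqxx.
have W1 (u : 'I_n) : (c <= (t1^-1)%g u) = W u by rewrite E W2.
rewrite (two_runs_pos v tt1) (two_runs_pos v tt2) W1 W2.
by rewrite (high_count W1) ?(high_count W2) // ltnW.
Qed.

(** The formula of [two_runs_pos] is used as a definition: [pos] is the inverse of the permutation
    sought. *)
Lemma two_runs_exists n c (W : pred nat) : c <= n -> count W (iota 0 n) = n - c ->
  exists t : 'S_n, two_runs c t /\ (forall v : 'I_n, (c <= (t^-1)%g v) = W v).
Proof.
move=> cn Wn; pose h v := count W (iota 0 v).
have hS v : h v.+1 = h v + W v by exact: count_iotaS.
have hD u v : u <= v -> h u <= h v <= h u + (v - u) by exact: count_iotaD.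
have h0 v : h v <= v by rewrite -[X in _ <= X](size_iota 0 v) count_size.
have hn : h n = n - c by [].
pose pos v := if W v then c + h v else v - h v.
have posn (v : 'I_n) : pos v < n.
  have vn := ltn_ord v; have := hD _ _ vn; rewrite hS hn /pos.
  by have := h0 v; case: (W v) => /=; lia.
have Wpos (v : 'I_n) : (c <= pos v) = W v.
  have vn := ltn_ord v; have := hD _ _ vn; rewrite hS hn /pos.
  by have := h0 v; case: (W v) => /=; lia.
have mono u v : u < v -> W u = W v -> pos u < pos v.
  move=> uv; have := hD _ _ uv; rewrite hS /pos => h1 WW; move: h1; rewrite WW.
  by have := h0 v; have := h0 u; case: (W v) => /=; lia.
pose g (v : 'I_n) := Ordinal (posn v).
have ginj : injective g.
  move=> u v /(congr1 val) /= E; apply: val_inj => /=.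
  have Wuv : W u = W v by rewrite -!Wpos E.
  have := @mono u v; have := @mono v u; rewrite Wuv E ltnn.
  by case: ltngtP => // _ H1 H2; [have := H1 isT erefl|have := H2 isT erefl].
exists ((perm ginj)^-1)%g.
have invE v : (((perm ginj)^-1)^-1)%g v = pos v :> nat by rewrite invgK permE.
have WE (v : 'I_n) : (c <= (((perm ginj)^-1)^-1)%g v) = W v by rewrite invE Wpos.
split=> //; set t := ((perm ginj)^-1)%g in invE WE *.
have key (p q : 'I_n) : (c <= p) = (c <= q) -> p < q -> t p < t q.
  move=> E pq; have WW : W (t p) = W (t q) by rewrite -!WE !permK.
  rewrite ltnNge leq_eqVlt; apply/negP => /orP[/eqP/val_inj/perm_inj qp|tqp].
    by rewrite qp ltnn in pq.
  by have := mono _ _ tqp (esym WW); rewrite -!invE !permK; lia.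
by split=> p q h1 h2; apply: key => //; lia.
Qed.

Fixpoint dyck (h : nat) (w : seq bool) : bool :=
  match w with
  | [::] => h == 0
  | true :: w' => dyck h.+1 w'
  | false :: w' => if h is h'.+1 then dyck h' w' else false
  end.

(** After [j] steps, [u] of them up, the height is [h + 2u - j]; the additive form avoids truncated
    subtraction. *)
Lemma dyckP h w :
  reflect ((forall j, j <= size w -> j <= h + (count id (take j w)).*2) /\
           h + (count id w).*2 = size w) (dyck h w).
Proof.
elim: w h => [|[] w IH] h /=.
- by apply: (iffP eqP) => [->|[_]]; [split=> // j; lia | lia].
- apply: (iffP (IH _)) => -[H E]; split; try lia.
    by case=> // j jw; have := H j jw; rewrite /=; lia.
  by move=> j jw; have := H j.+1 jw; rewrite /=; lia.
case: h => [|h].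
  by apply: ReflectF => -[/(_ 1 isT)]; rewrite /= take0.
apply: (iffP (IH _)) => -[H E]; split; try lia.
  by case=> // j jw; have := H j jw; rewrite /=; lia.
by move=> j jw; have := H j.+1 jw; rewrite /=; lia.
Qed.

Lemma card_tuple_boolS k (P : pred (seq bool)) :
  #|[set w : k.+1.-tuple bool | P w]| =
  #|[set w : k.-tuple bool | P (true :: w)]| + #|[set w : k.-tuple bool | P (false :: w)]|.
Proof.
have cinj b : injective (fun w : k.-tuple bool => [tuple of b :: w]).
  by move=> u v /(congr1 val) [] /val_inj.
rewrite -(card_imset _ (cinj true)) -(card_imset _ (cinj false)) -cardsUI.
rewrite [X in _ + X](_ : _ = 0) ?addn0; last first.
  apply/eqP; rewrite cards_eq0; apply/eqP/setP => w; rewrite !inE.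
  by apply/negP => /andP[/imsetP[u _ ->] /imsetP[v _ /(congr1 val)]].
apply: eq_card => w; rewrite !inE; apply/idP/orP => [|[] /imsetP[u]]; last 2 first.
- by rewrite inE => Pu ->.
- by rewrite inE => Pu ->.
case/tupleP: w => -[] w Pw; [left|right]; apply/imsetP; exists w; rewrite ?inE //.
Qed.

(* The ballot number C(k,u) - C(k,u-1), where [u] counts the up-steps. *)
Lemma card_dyck k h u : k = u.*2 + h ->
  #|[set w : k.-tuple bool | dyck h w]| + (if u is u'.+1 then 'C(k, u') else 0) = 'C(k, u).
Proof.
elim: k h u => [|k IH] h u kE.
  have [-> ->] : u = 0 /\ h = 0 by lia.
  rewrite addn0 bin0; transitivity #|[set: 0.-tuple bool]|; last by rewrite cardsT card_tuple.
  by apply: eq_card => w; rewrite !inE tuple0.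
rewrite (card_tuple_boolS _ (dyck h)) /=.
case: u kE => [|u] kE.
  case: h kE => [//|h] kE.
  have H2 := IH h 0 ltac:(lia).
  rewrite addn0 !bin0 in H2 *; rewrite H2.
  suff -> : #|[set w : k.-tuple bool | dyck h.+2 w]| = 0 by [].
  apply: eq_card0 => w; rewrite !inE; apply/negP => /dyckP[_].
  by rewrite size_tuple; lia.
have H1 := IH h.+1 u ltac:(lia).
case: h kE H1 => [|h] kE H1.
  have -> : #|[set w : k.-tuple bool | false]| = 0 by apply: eq_card0 => w; rewrite inE.
  (* No down-step is possible at height 0. The term missing from the recursion is the difference of
     these binomials, which vanishes because [k = 2u + 1]. *)
  have B : 'C(k, u.+1) = 'C(k, u) by rewrite -bin_sub; [congr ('C(_, _))|]; lia.
  move: H1; set x := #|[set w : k.-tuple bool | dyck 1 w]| => H1.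
  by case: u kE H1 B => [|u] kE H1 B; rewrite ?binS ?bin0 ?binS in H1 B *; lia.
have H2 := IH h u.+1 ltac:(lia).
move: H1 H2; set x := #|[set w : k.-tuple bool | dyck h.+2 w]|.
set y := #|[set w : k.-tuple bool | dyck h w]| => H1 H2.
by case: u kE H1 H2 => [|u] kE H1 H2; rewrite ?binS ?bin0 in H1 H2 *; lia.
Qed.

Lemma card_dyck_catalan r : #|[set w : r.*2.-tuple bool | dyck 0 w]| = catalan r.
Proof.
have := @card_dyck r.*2 0 r; rewrite addn0 => /(_ erefl); rewrite /catalan.
case: r => [|r] H; first by move: H; rewrite addn0 => ->.
have := mul_bin_left (r.+1).*2 r; rewrite (_ : r.+1.*2 - r = r.+2); last by lia.
(* Being an exact multiple of [r.+2], the central binomial is divided without remainder in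
   [catalan]. *)
move=> B; have -> : 'C(r.+1.*2, r.+1) = #|[set w : r.+1.*2.-tuple bool | dyck 0 w]| * r.+2 by nia.
by rewrite mulnK.
Qed.

(** * The surviving permutations *)

(* The first pair of steps is always up and the last always down; [b] lists the
   pairs in between, and the out-of-range default [false] of [nth] provides
   the final down pair. *)
Definition doubled_word (a : nat) (b : seq bool) (v : nat) : bool :=
  (a <= v) && nth false (true :: b) (v - a)./2.

Lemma count_take_S (s : seq bool) k :
  count id (take k.+1 s) = count id (take k s) + nth false s k.
Proof.
elim: s k => [|x s IH] [|k] //=; first by rewrite take0 addn0.
by rewrite IH addnA.
Qed.

Lemma count_doubled_word a b k :
  count (doubled_word a b) (iota 0 (a + k.*2)) = (count id (take k (true :: b))).*2.
Proof.
elim: k => [|k IH].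
  rewrite addn0 take0 (eq_in_count (a2 := pred0)) ?count_pred0 // => v.
  by rewrite mem_iota /doubled_word /= => va; rewrite leqNgt va.
rewrite doubleS !addnS !count_iotaS IH count_take_S doubleD -addnA.
rewrite /doubled_word leqW ?leq_addr //= -addnS !addKn.
by rewrite doubleK -[k.*2.+1./2]/(uphalf k.*2) uphalf_double addnn.
Qed.

(** At pair boundaries the height is twice that of [true :: b]. Inside the path it is positive there
    exactly when [b], started one level up, never goes below 0. *)
Lemma prime_shuffle_doubled n' a m (t : 'S_n'.+1) (b : seq bool) :
  n'.+1 = a + m.+2.*2 -> odd a -> size b = m ->
  two_runs (a + m.+2) t ->
  (forall v : 'I_n'.+1, (a + m.+2 <= (t^-1)%g v) = doubled_word a b v) ->
  prime_shuffle a m.+2 t <-> dyck 0 b.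
Proof.
move=> nE ao bm tt tW; have hE := high_count tW.
have h2 k : k <= m.+2 ->
    high (a + m.+2) t (a + k.*2) = (count id (take k (true :: b))).*2.
  by move=> km; rewrite hE ?count_doubled_word //; lia.
have total : (count id b).*2 = m.
  have := high_total t (_ : a + m.+2 <= n'.+1); rewrite {3}nE h2 //= take_oversize ?bm //.
  by move=> /(_ ltac:(lia)); lia.
split=> [[_ _ H]|/dyckP[H _]].
  apply/dyckP; split; last by rewrite bm add0n.
  move=> j; rewrite bm => jm; have := H (a + j.+1.*2); rewrite h2 /=; last by lia.
  by move=> /(_ ltac:(lia) ltac:(lia)); lia.
(* A positive height at a pair boundary is at least 2, so the midpoint of the next pair stays
   positive as well. *)
have H' k : 0 < k -> k < m.+2 -> a + k.*2.+1 < (high (a + m.+2) t (a + k.*2)).*2 + a.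
  case: k => // k _ km; rewrite h2 //=; last exact: ltnW.
  by have := H k; rewrite bm => /(_ ltac:(lia)); lia.
split=> //; first by have := h2 0 isT; rewrite addn0 take0.
move=> v av vn; pose k := (v - a)./2.
have vE : v = a + (odd (v - a) + k.*2) by rewrite odd_double_half subnKC // ltnW.
have km : k < m.+2 by case: odd vE; lia.
have [k0|k0] := posnP k.
  have v1 : v = a.+1 by rewrite k0 in vE; case: odd vE; lia.
  have an : a < n'.+1 by lia.
  have := highS (a + m.+2) t (Ordinal an).
  by rewrite tW /doubled_word /= leqnn subnn /= v1; lia.
have hm : high (a + m.+2) t (a + k.*2) <= high (a + m.+2) t v.
  by apply: high_homo; rewrite [X in _ <= X]vE; lia.
by have := H' k k0 km; case: odd vE; lia.
Qed.

(** Since [a] is odd, the pairs of letters starting at [a] are pairs of partner values. *)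
Lemma doubled_word_partner n' a b (v : 'I_n'.+1) : ~~ odd n' -> odd a ->
  doubled_word a b (partner v) = doubled_word a b v.
Proof.
move=> n'odd ao; rewrite val_partner //.
have key u : odd u -> doubled_word a b u.+1 = doubled_word a b u.
  move=> ou; rewrite /doubled_word (_ : (a <= u.+1) = (a <= u)); last by lia.
  by case: leqP => //= au; congr (nth _ _ _); lia.
case: (posnP v) => [->//|v0]; case: ifP => ov; first exact: key.
by rewrite -key ?prednK //; lia.
Qed.

(** One letter per pair suffices. The index [j.+1] skips the first pair, which positivity forces
    up. *)
Lemma prime_shuffle_word n' a m (t : 'S_n'.+1) :
  n'.+1 = a + m.+2.*2 -> odd a -> prime_shuffle a m.+2 t ->
  (forall v, ~~ mixed (a + m.+2) t v) ->
  forall v : 'I_n'.+1, (a + m.+2 <= (t^-1)%g v) =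
    doubled_word a (mkseq (fun j => a + m.+2 <= (t^-1)%g (inord (a + j.+1.*2))) m) v.
Proof.
move=> nE ao [tt h0 H] um; have n'odd := odd_complement nE ao.
have WE (v : 'I_n'.+1) : (a + m.+2 <= (t^-1)%g (partner v)) = (a + m.+2 <= (t^-1)%g v).
  by have := um v; rewrite /mixed negbK => /eqP.
set b := mkseq _ _.
have lowcase (v : 'I_n'.+1) : v < a -> (a + m.+2 <= (t^-1)%g v) = doubled_word a b v.
  move=> va; have := high_homo (a + m.+2) t va.
  by rewrite /doubled_word (leqNgt a) va h0 highS /=; case: (a + m.+2 <= _); lia.
have oddcase (v : 'I_n'.+1) : odd v -> (a + m.+2 <= (t^-1)%g v) = doubled_word a b v.
  move=> ov; have vn := ltn_ord v; have S := highS (a + m.+2) t v.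
  have [av|] := leqP a v; last exact: lowcase.
  rewrite /doubled_word av /=.
  have vE : v = a + ((v - a)./2).*2 :> nat by lia.
  case: ((v - a)./2) vE => [|k] vE.
    rewrite /= addn0 in vE *; have := H a.+1; rewrite vE h0 in S; rewrite S.
    by case: (a + m.+2 <= _); lia.
  rewrite /=; have [km|mk] := ltnP k m.
    by rewrite nth_mkseq // -vE inord_val.
  (* This is the last pair, at [v = n - 2]: were it up, only [m] up-steps would precede it and the
     path would already be at height 0. *)
  rewrite nth_default ?size_mkseq //.
  have pE := val_partner v n'odd; rewrite ov gtn_eqF ?odd_gt0 // in pE.
  have S2 := highS (a + m.+2) t (partner v).
  have tot : high (a + m.+2) t v.+2 = m.+2.
    by rewrite (_ : v.+2 = n'.+1) ?high_total; lia.
  have := H v; rewrite WE pE tot S in S2.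
  by case: (a + m.+2 <= _) S2 => /=; lia.
move=> v; have [v0|v0] := posnP v; first by apply: lowcase; rewrite v0 odd_gt0.
have [|ev] := boolP (odd v); first exact: oddcase.
rewrite -WE -(doubled_word_partner _ _ n'odd ao); apply: oddcase.
by rewrite val_partner // gtn_eqF // (negbTE ev); lia.
Qed.

(** Reading off the middle pairs is injective because the path determines the permutation, and onto
    because each doubled Dyck word is the path of some permutation with two runs. *)
Lemma card_unmixed n' a m :
  n'.+1 = a + m.+2.*2 -> odd a ->
  #|[set t : 'S_n'.+1 | ((t ord0 == ord0) && extremal_hits a m.+2 t) &&
       [forall v, ~~ mixed (a + m.+2) t v]]| =
  #|[set b : m.-tuple bool | dyck 0 b]|.
Proof.
move=> nE ao; have n'odd := odd_complement nE ao; have a0 := odd_gt0 ao.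
set F := [set t | _].
have FP (t : 'S_n'.+1) : t \in F <-> prime_shuffle a m.+2 t /\ (forall v, ~~ mixed (a + m.+2) t v).
  rewrite inE; split=> [/andP[/(extremal_hitsP _ nE a0 isT) ? /forallP //]|[? ?]].
  by apply/andP; split; [exact/(extremal_hitsP _ nE a0 isT) | exact/forallP].
pose word (t : 'S_n'.+1) : m.-tuple bool :=
  [tuple a + m.+2 <= (t^-1)%g (inord (a + j.+1.*2)) | j < m].
have wordE t : tval (word t) = mkseq (fun j => a + m.+2 <= (t^-1)%g (inord (a + j.+1.*2))) m.
  by rewrite /= /mkseq -val_enum_ord -map_comp.
have FW t : t \in F -> forall v : 'I_n'.+1,
    (a + m.+2 <= (t^-1)%g v) = doubled_word a (word t) v.
  by move=> /FP[E um] v; rewrite (prime_shuffle_word nE ao E um) -wordE.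
have winj : {in F &, injective word}.
  move=> t1 t2 F1 F2 E; have [[tt1 _ _] _] := (FP t1).1 F1; have [[tt2 _ _] _] := (FP t2).1 F2.
  by apply: (two_runs_inj tt1 tt2) => v; rewrite !FW // E.
rewrite -(card_in_imset winj); apply: eq_card => b; rewrite inE; apply/imsetP/idP.
  case=> t Ft ->; have [E _] := (FP t).1 Ft; have [tt _ _] := E.
  by apply: (prime_shuffle_doubled nE ao _ tt (FW t Ft)).1; rewrite ?size_tuple.
move=> db; have cn : a + m.+2 <= n'.+1 by lia.
have [|t [tt tW]] := @two_runs_exists n'.+1 (a + m.+2) (doubled_word a b) cn.
  rewrite {1}nE count_doubled_word take_oversize /= ?size_tuple //.
  by have /dyckP[_] := db; rewrite size_tuple; lia.
have E := (prime_shuffle_doubled nE ao (size_tuple b) tt tW).2 db.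
have um v : ~~ mixed (a + m.+2) t v.
  by rewrite /mixed !tW doubled_word_partner // eqxx.
exists t; first by apply/FP.
apply: val_inj; rewrite -[RHS]/(tval (word t)) wordE.
apply: (@eq_from_nth _ false); rewrite size_tuple ?size_mkseq //.
move=> j jm; rewrite nth_mkseq // tW inordK; last by lia.
by rewrite /doubled_word leq_addr addKn doubleK.
Qed.

Theorem theorem2p22 (c n : nat) :
  odd c -> odd n -> c < n -> n < c.*2 ->
  #|[set s : 'S_n | nonavoider c s && odd_perm s]| =
  #|[set s : 'S_n | nonavoider c s && ~~ odd_perm s]|
    + n * catalan ((n - c - 2)./2).
Proof.
move=> oc on cn nc; case: n on cn nc => // n' on cn nc.
(* Here [n - c] is even and positive, so [m = 2r + 2] and the middle words have length [m - 2 = 2r];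
   [n < 2c] makes [a] positive. *)
have [r mE] : exists r, n'.+1 - c = r.*2.+2 by exists ((n'.+1 - c - 2)./2); lia.
pose a := c - r.*2.+2.
have nE : n'.+1 = a + r.*2.+2.*2 by rewrite /a; lia.
have ao : odd a by rewrite /a; lia.
have a0 := odd_gt0 ao; have n'odd := odd_complement nE ao.
have cE : c = a + r.*2.+2 by rewrite /a; lia.
have cs b : #|[set s : 'S_n'.+1 | nonavoider c s && (odd_perm s == b)]| =
    card_sign (@nonavoider (a + r.*2.+2) n'.+1) b by rewrite cE.
have := cs true; have := cs false.
rewrite (_ : (n'.+1 - c - 2)./2 = r); last by rewrite mE; lia.
rewrite -card_dyck_catalan -(card_unmixed nE ao).
have := card_sign_nonavoider nE a0 isT n'odd.
rewrite (card_sign_prime_shuffle nE ao _ _) //; last by rewrite /= odd_double.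
rewrite mulnDr => H E0 E1.
rewrite (eq_card (B := [set s : 'S_n'.+1 | nonavoider c s && (odd_perm s == true)])); last first.
  by move=> s; rewrite !inE eqb_id.
rewrite E1 (eq_card (A := [set s : 'S_n'.+1 | nonavoider c s && ~~ odd_perm s])
  (B := [set s : 'S_n'.+1 | nonavoider c s && (odd_perm s == false)])); last first.
  by move=> s; rewrite !inE eqbF_neg.
by rewrite E0; move: H; lia.
Qed.
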